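(* Let $x_F$ be the Fibonacci word, the fixed point of $0\mapsto 01$, $1\mapsto 0$, let $\mathcal{L}_F$ be the set of nonempty finite factors of $x_F$, and let $S:\mathcal{L}_F\to\mathbb{N}$ be given by $S(w)=3|w|_0+|w|_1$ (so $S(0)=a=3$, $S(1)=b=1$). Let $C$ be the increasing enumeration of $\mathbb{N}\setminus S(\mathcal{L}_F)$ and $\Delta C=(C(n+1)-C(n))_{n\ge1}$. Let $x_H$ be the fixed point starting with $a$ of the morphism $h$ on $\{a,b\}$ given by $h(a)=aab$, $h(b)=ab$. Then $\Delta C=\delta(x_H)$, where $\delta:\{a,b\}\to\{7,11\}^*$ is the morphism $\delta(a)=7\,11$ (the two-letter word with letters $7$ and $11$), $\delta(b)=11$ (the one-letter word $11$).
   Context: $\mathbb{N}=\{1,2,3,\dots\}$. $|w|_0,|w|_1$ denote the numbers of occurrences of $0$ and $1$ in $w$; $S$ is the homomorphism of the Fibonacci language into $\mathbb{N}$ with $S(0)=3$, $S(1)=1$. $\Delta C$ is regarded as an infinite word over the alphabet of positive integers, and $\delta(x_H)$ is the concatenation of the images of the letters of $x_H$. *)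

(* Defs.v *)
From mathcomp Require Import all_boot.

Set Implicit Arguments.
Unset Strict Implicit.
Unset Printing Implicit Defensive.

(* An infinite word x is a function on nat whose first letter is x 0.         *)
(* A morphism of free monoids is given by its values on letters.              *)

Definition morph_word (A B : Type) (f : A -> seq B) (w : seq A) : seq B :=
  flatten [seq f c | c <- w].

(* y = f(x) for infinite words: y begins with the image of every finite       *)
(* prefix of x. This determines y as soon as f maps no letter to the empty    *)
(* word (more generally, as soon as these images are arbitrarily long).       *)
Definition is_image (A B : Type) (f : A -> seq B) (x : nat -> A)
    (y : nat -> B) : Prop :=
  forall n, let w := morph_word f (mkseq x n) in w = mkseq y (size w).

Definition fixed_point (A : Type) (f : A -> seq A) (x : nat -> A) : Prop :=
  is_image f x x.

Definition factor (A : Type) (x : nat -> A) (w : seq A) : Prop :=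
  exists i, w = mkseq (fun j => x (i + j)) (size w).

Definition language (A : Type) (x : nat -> A) (w : seq A) : Prop :=
  w <> [::] /\ factor x w.

(* The letters 0 and 1 are encoded as false and true. *)
Definition fib_morph (c : bool) : seq bool :=
  if c then [:: false] else [:: false; true].

Definition S_F (w : seq bool) : nat := 3 * count_mem false w + count_mem true w.

(* The complement is taken in the set of positive integers. *)
Definition S_complement (xF : nat -> bool) (m : nat) : Prop :=
  0 < m /\ ~ (exists2 w, language xF w & S_F w = m).

(* Indices are shifted by one: C 0 is the smallest element of P. *)
Definition increasing_enumeration (P : nat -> Prop) (C : nat -> nat) : Prop :=
  (forall n, C n < C n.+1) /\ (forall m, P m <-> exists n, C n = m).

(* Only applied to increasing sequences, where the subtraction is exact. *)
Definition Delta (C : nat -> nat) (n : nat) : nat := C n.+1 - C n.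

Variant letter := La | Lb.

Definition h (c : letter) : seq letter :=
  match c with La => [:: La; La; Lb] | Lb => [:: La; Lb] end.

Definition delta (c : letter) : seq nat :=
  match c with La => [:: 7; 11] | Lb => [:: 11] end.

Lemma morph_word_cat (A B : Type) (f : A -> seq B) (u v : seq A) :
  morph_word f (u ++ v) = morph_word f u ++ morph_word f v.
Proof. by rewrite /morph_word map_cat flatten_cat. Qed.

Lemma size_morph_word (A B : Type) (f : A -> seq B) (w : seq A) :
  (forall c, 0 < size (f c)) -> size w <= size (morph_word f w).
Proof.
move=> f0; elim: w => //= c w IH.
by rewrite /morph_word /= size_cat -addn1 addnC leq_add.
Qed.

Lemma fixed_point_exists (A : Type) (f : A -> seq A) (c : A) (u : seq A) :
  (forall d, 0 < size (f d)) -> f c = c :: u -> 0 < size u ->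
  exists x, x 0 = c /\ fixed_point f x.
Proof.
move=> f0 fc u0; pose w n := iter n (morph_word f) [:: c].
have wS n : w n.+1 = morph_word f (w n) by [].
have wE n : exists2 v, w n.+1 = w n ++ v & 0 < size v.
  elim: n => [|n [v e v0]]; first by exists u; rewrite //= /morph_word /= cats0.
  exists (morph_word f v); last exact: leq_trans v0 (size_morph_word _ f0).
  by rewrite [LHS]wS [in LHS]e morph_word_cat.
have wle m n : m <= n -> exists v, w n = w m ++ v.
  move=> le; rewrite -(subnKC le); elim: (n - m) => [|k [v e]].
    by exists [::]; rewrite addn0 cats0.
  have [v' e' _] := wE (m + k).
  by exists (v ++ v'); rewrite addnS e' e catA.
have szw n : n < size (w n).
  elim: n => // n IH; have [v -> v0] := wE n.
  by rewrite size_cat -addn1 leq_add.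
pose x n := nth c (w n) n.
have xw m n : n < size (w m) -> nth c (w m) n = x n.
  move=> lt; rewrite /x; case: (leqP m n) => [|/ltnW] /wle [v ->];
    by rewrite nth_cat ?lt ?szw.
have pre m k : k <= size (w m) -> mkseq x k = take k (w m).
  move=> le; apply: (@eq_from_nth _ c); first by rewrite size_mkseq size_takel.
  move=> i; rewrite size_mkseq => ik.
  by rewrite nth_mkseq // nth_take // xw // (leq_trans ik).
exists x; split=> // n /=.
have e := pre n n (ltnW (szw n)).
have ws : morph_word f (mkseq x n) ++ morph_word f (drop n (w n)) = w n.+1.
  by rewrite e -morph_word_cat cat_take_drop.
set v := morph_word f (mkseq x n) in ws *.
by rewrite (pre n.+1 (size v)) -ws ?take_size_cat // size_cat leq_addr.
Qed.

Lemma fib_word_exists : exists xF, fixed_point fib_morph xF.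
Proof.
have [|x [_ fx]] := @fixed_point_exists _ fib_morph false [:: true] _ erefl erefl.
  by case.
by exists x.
Qed.

Lemma h_word_exists : exists xH, xH 0 = La /\ fixed_point h xH.
Proof.
by apply: (@fixed_point_exists _ h La [:: La; Lb] _ erefl erefl); case.
Qed.

(* Main.v *)
(* The balance of the Sturmian word x_F, together with the fact that its       *)
(* prefixes p are left special, shows that S takes exactly the values          *)
(* 1 + S(p) and 3 + S(p). Replace each letter of x_F by a block on the line    *)
(* starting at 1, of length S(0) = 3 or S(1) = 1; the values of S are then     *)
(* the starts of the blocks and these starts shifted by 2. So the missing      *)
(* integers are the middles of the 0-blocks preceded by a 0-block, with a      *)
(* virtual 0 in front of x_F. They cut x_F into the factors 010 and 01010,     *)
(* of weights 7 and 11. With g(a) = 01001010 and g(b) = 01010 one has          *)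
(* g h = f^2 g for the Fibonacci morphism f, so g(x_H) = x_F, and this         *)
(* factorization reads delta(x_H).                                             *)
Require Import Defs.
From mathcomp Require Import all_boot all_order all_algebra.
From mathcomp Require Import realalg ring lra zify.
Import GRing.Theory Num.Theory Order.TTheory.

Set Implicit Arguments.
Unset Strict Implicit.

(** Since [S_F w] is 3|w| - 2|w|_1, only the possible numbers of ones in a factor of given length
    matter. If P(n) counts the ones in the prefix of length n, [fib_count_add] leaves only P(n) and
    P(n) + 1 for factors of length n + 1, and [prefix_left_special] realizes both; this gives
    [S_language]. By [h_code_image] and [return_word_image], x_F is a product of the blocks 010 and
    01010 in the order dictated by delta(x_H). [complement_enumeration] finds one missing integer
    per block, always 2 past its start, so the gaps are the weights 7 and 11 of the blocks. *)

(** * Prefixes and morphic images of infinite words *)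

Lemma mkseq_addn (A : Type) (x : nat -> A) m n :
  mkseq x (m + n) = mkseq x m ++ mkseq (fun j => x (m + j)) n.
Proof.
by rewrite /mkseq iotaD map_cat add0n -[X in iota X n]addn0 iotaDl -map_comp.
Qed.

Lemma mkseq_cat1 (A : Type) (x : nat -> A) n : mkseq x n.+1 =
  mkseq x n ++ [:: x n].
Proof. by rewrite mkseqS cats1. Qed.

Definition prefix_word (A : Type) (x : nat -> A) (w : seq A) : Prop :=
  w = mkseq x (size w).

Lemma prefix_word_mkseq (A : Type) (x : nat -> A) n : prefix_word x (mkseq x n).
Proof. by rewrite /prefix_word size_mkseq. Qed.

Lemma cat_inj (A : Type) (u u' v v' : seq A) :
  size u = size u' -> u ++ v = u' ++ v' -> u = u' /\ v = v'.
Proof.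
move=> e E; split.
  by rewrite -(take_size_cat v (erefl (size u))) E e take_size_cat.
by rewrite -(drop_size_cat v (erefl (size u))) E e drop_size_cat.
Qed.

Lemma prefix_word_catl (A : Type) (x : nat -> A) u v :
  prefix_word x (u ++ v) -> prefix_word x u.
Proof.
rewrite {1}/prefix_word size_cat mkseq_addn => /cat_inj [] //.
by rewrite size_mkseq.
Qed.

Lemma prefix_word_catr (A : Type) (x : nat -> A) u v : prefix_word x (u ++ v) ->
  v = mkseq (fun j => x (size u + j)) (size v).
Proof.
rewrite {1}/prefix_word size_cat mkseq_addn => /cat_inj [] //.
by rewrite size_mkseq.
Qed.

Lemma prefix_word_le (A : Type) (x : nat -> A) w n :
  prefix_word x w -> n <= size w -> exists t, w = mkseq x n ++ t.
Proof.
by move=> pw /subnKC le; rewrite pw -le mkseq_addn; eexists.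
Qed.

Lemma prefix_word_image (A B : Type) (f : A -> seq B) x y w :
  is_image f x y -> prefix_word x w -> prefix_word y (morph_word f w).
Proof. by move=> im ->; apply: im. Qed.

Lemma morph_word_seq1 (A B : Type) (f : A -> seq B) c :
  morph_word f [:: c] = f c.
Proof. by rewrite /morph_word /= cats0. Qed.

Lemma morph_word_comp (A B D : Type) (f : B -> seq D) (g : A -> seq B) w :
  morph_word f (morph_word g w) = morph_word (fun c => morph_word f (g c)) w.
Proof.
elim: w => // c w IH.
by rewrite [RHS]/morph_word /= -[RHS]/(_ ++ morph_word _ w) -IH -morph_word_cat.
Qed.

(** Letter n is read in the image of the prefix of length n + 1, which has at least n + 1 letters,
    so the default [b] is never returned. *)
Lemma image_exists (A B : Type) (f : A -> seq B) (b : B) (x : nat -> A) :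
  (forall c, 0 < size (f c)) -> exists y, is_image f x y.
Proof.
move=> f0; pose w n := morph_word f (mkseq x n).
have szw n : n <= size (w n).
  by rewrite -{1}(size_mkseq x n) size_morph_word.
have wD m k : exists t, w (m + k) = w m ++ t.
  by rewrite /w mkseq_addn morph_word_cat; eexists.
exists (fun n => nth b (w n.+1) n) => n /=.
apply: (@eq_from_nth _ b); first by rewrite size_mkseq.
move=> i lt_i; rewrite nth_mkseq // -/(w n).
case: (leqP i.+1 n) => [|/ltnW] /subnKC <-.
  by have [t ->] := wD i.+1 (n - i.+1); rewrite nth_cat szw.
by have [t ->] := wD n (i.+1 - n); rewrite nth_cat lt_i.
Qed.

(** * Balance and left special prefixes of the Fibonacci word *)

Lemma count_morph_fib (b : bool) (w : seq bool) :
  count_mem b (morph_word fib_morph w) =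
  if b then count_mem false w else size w.
Proof.
elim: w => [|c w IH]; first by case: b.
by rewrite -cat1s morph_word_cat morph_word_seq1 count_cat IH; case: b c {IH} => -[].
Qed.

Lemma size_count_bool (w : seq bool) :
  count_mem false w + count_mem true w = size w.
Proof. by elim: w => //= -[] w <-; lia. Qed.

Lemma size_morph_fib (w : seq bool) :
  size (morph_word fib_morph w) + count_mem true w = 2 * size w.
Proof.
have := size_count_bool (morph_word fib_morph w).
by rewrite !count_morph_fib; have := size_count_bool w; lia.
Qed.

Lemma fib0 xF : fixed_point fib_morph xF -> xF 0 = false.
Proof.
by move=> /(_ 1); rewrite /morph_word /mkseq /=; case E: (xF 0) => //=; rewrite E.
Qed.

Lemma fib_prefix8 xF : fixed_point fib_morph xF ->
  prefix_word xF [:: false; true; false; false; true; false; true; false].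
Proof.
move=> hF; have p1 : prefix_word xF [:: false].
  by rewrite /prefix_word /mkseq /= (fib0 hF).
have p2 := prefix_word_image hF p1; have p3 := prefix_word_image hF p2.
exact: (prefix_word_image hF (prefix_word_image hF p3)).
Qed.

(* x_F is Sturmian of slope al, the smaller root of X^2 - 3X + 1: its prefix   *)
(* of length n contains floor ((n + 1) al) ones. The induction follows         *)
(* x_F = fib_morph(x_F), which turns a prefix of length n with k ones into     *)
(* one of length 2n - k with n - k ones.                                       *)
Lemma fib_count_bounds (R : realFieldType) (al : R) (xF : nat -> bool) :
  (al ^+ 2 = 3 * al - 1)%R -> (0 < al)%R -> (al < 1/2)%R ->
  fixed_point fib_morph xF -> forall n,
  ((count_mem true (mkseq xF n))%:R < n.+1%:R * al)%R /\
  (n.+1%:R * al < (count_mem true (mkseq xF n)).+1%:R)%R.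
Proof.
move=> al2 al0 al1 hF.
pose P n := count_mem true (mkseq xF n).
pose L n := size (morph_word fib_morph (mkseq xF n)).
suff bnd N : forall n, n <= L N ->
    ((P n)%:R < n.+1%:R * al)%R /\ (n.+1%:R * al < (P n).+1%:R)%R.
  move=> n; apply: (bnd n); rewrite /L -{1}(size_mkseq xF n) size_morph_word //.
  by case.
elim: N => [|N IH] n.
  by rewrite leqn0 => /eqP ->; rewrite /P /=; split; lra.
have LE M : L M + P M = 2 * M.
  by rewrite /L /P size_morph_fib size_mkseq.
have PL M : P (L M) + P M = M.
  rewrite {1}/P /L -(hF M) count_morph_fib /P.
  by rewrite size_count_bool size_mkseq.
have LN : N <= L N by rewrite /L -{1}(size_mkseq xF N) size_morph_word //; case.
have [lo hi] := IH N LN.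
have PS M : P M.+1 = P M + xF M.
  by rewrite /P mkseq_cat1 count_cat /=; case: (xF M).
have xLN : xF (L N) = false /\ (xF N = false -> L N.+1 = (L N).+2).
  have := prefix_word_image hF (prefix_word_mkseq xF N.+1).
  rewrite mkseq_cat1 morph_word_cat morph_word_seq1 => /prefix_word_catr.
  rewrite /L mkseq_cat1 morph_word_cat morph_word_seq1 size_cat.
  by rewrite /mkseq; case: (xF N) => /= -[]; rewrite addn0 => <-; rewrite ?addn2.
have [{}xLN LS] := xLN.
have LEN := LE N; have PLN := PL N.
have {LEN} LEN : ((L N)%:R = 2 * N%:R - (P N)%:R :> R)%R.
  by apply/eqP; rewrite eq_sym subr_eq -natrM -natrD LEN.
have {PLN} PLN : ((P (L N))%:R = N%:R - (P N)%:R :> R)%R.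
  by apply/eqP; rewrite eq_sym subr_eq -natrD PLN.
(* Multiplying the bounds at N by 1 - al yields the terms of the bounds near [L N], with no square
   of [al] left. *)
have alE : (al * (1 - al) = 1 - 2 * al)%R.
  by rewrite mulrBr -expr2 al2; ring.
have lo' : ((P N)%:R * (1 - al) < N.+1%:R * (1 - 2 * al))%R.
  by rewrite -alE mulrA ltr_pM2r //; lra.
have hi' : (N.+1%:R * (1 - 2 * al) < (P N).+1%:R * (1 - al))%R.
  by rewrite -alE mulrA ltr_pM2r //; lra.
have b1 : ((P (L N).+1)%:R < (L N).+2%:R * al)%R /\
          ((L N).+2%:R * al < (P (L N).+1).+1%:R)%R.
  move: lo hi lo' hi'; rewrite PS xLN addn0 -!(natr1 (L N).+1) -!natr1 PLN LEN.
  by split; lra.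
move=> le_n; have [le|lt] := leqP n (L N); first exact: IH.
have [->|ne] := eqVneq n (L N).+1; first exact: b1.
have [xN nE] : xF N = false /\ n = (L N).+2.
  have := LE N.+1; have := LE N; rewrite PS.
  by case: (xF N) LS => [_|/(_ erefl)]; lia.
(* As N <= L N, the induction hypothesis misses N + 1 only if L N = N, and then [b1] is the
   claim. *)
have [lo2 hi2] : ((P N.+1)%:R < N.+2%:R * al)%R /\
     (N.+2%:R * al < (P N.+1).+1%:R)%R.
  have [le|lt2] := leqP N.+1 (L N); first exact: IH.
  by have -> : N.+1 = (L N).+1 by lia.
have hi2' : (N.+2%:R * (1 - 2 * al) < (P N.+1).+1%:R * (1 - al))%R.
  by rewrite -alE mulrA ltr_pM2r //; lra.
have PLN1 := PL N.+1; rewrite PS xN addn0 (LS xN) in PLN1.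
have {}PLN1 : ((P (L N).+2)%:R = N.+1%:R - (P N)%:R :> R)%R.
  by apply/eqP; rewrite eq_sym subr_eq -natrD PLN1.
move: lo hi lo2 hi2 hi2'; rewrite nE (PS N) xN addn0.
rewrite -!(natr1 (L N).+2) -!(natr1 (L N).+1) -!natr1 PLN1 LEN -!natr1.
by split; lra.
Qed.

(** The bounds of [fib_count_bounds] add up, because (i + n + 2) al = (i + 1) al + (n + 1) al;
    rounding leaves two values. *)
Lemma fib_count_add xF : fixed_point fib_morph xF -> forall i n,
  count_mem true (mkseq xF i) + count_mem true (mkseq xF n) <=
    count_mem true (mkseq xF (i + n.+1)) <=
    (count_mem true (mkseq xF i) + count_mem true (mkseq xF n)).+1.
Proof.
move=> hF i n; set P := fun k => count_mem true (mkseq xF k).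
rewrite -!/(P _); pose s : realalg := Num.sqrt 5%:R.
have s2 : (s ^+ 2 = 5)%R by rewrite sqr_sqrtr // ler0n.
have s0 : (0 <= s)%R by apply: sqrtr_ge0.
pose al : realalg := ((3 - s) / 2)%R.
have al2 : (al ^+ 2 = 3 * al - 1)%R.
  have -> : (al ^+ 2 = (9 - 6 * s + s ^+ 2) / 4)%R by rewrite /al; field.
  by rewrite s2 /al; field.
have sP : (2 < s)%R by nra.
have s3 : (s < 3)%R by nra.
have al0 : (0 < al)%R by rewrite /al; lra.
have al1 : (al < 1 / 2)%R by rewrite /al; lra.
have bnd := fib_count_bounds al2 al0 al1 hF.
have [li hi] := bnd i; have [ln hn] := bnd n; have [lm hm] := bnd (i + n.+1).
rewrite -/(P _) in li hi ln hn lm hm.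
have e : ((i + n.+1).+1%:R = i.+1%:R + n.+1%:R :> realalg)%R by rewrite -natrD.
rewrite e mulrDl in lm hm.
apply/andP.
by split; rewrite -ltnS -(ltr_nat realalg) -?addnS ?natrD -!natr1;
  rewrite -!natr1 in hi hn hm; lra.
Qed.

Lemma prefix_left_special xF : fixed_point fib_morph xF -> forall n c,
  exists u, prefix_word xF (u ++ c :: mkseq xF n).
Proof.
move=> hF n c; have x0 := fib0 hF.
(* A nonempty prefix starts with 0, so its image is strictly longer and the induction gains a
   letter. The image of 0 ends in 1 and that of 1 ends in 0, hence the hypothesis is used for the
   opposite letter. *)
suff [u pu] : exists u, prefix_word xF (u ++ c :: mkseq xF n.+1).
  exists u; move: pu; rewrite mkseq_cat1 -cat_cons catA.
  exact: prefix_word_catl.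
elim: n c => [|n IH] c.
  have p8 := fib_prefix8 hF; rewrite /mkseq /= x0.
  case: c; first by exists [:: false];
    exact: (@prefix_word_catl _ xF [:: false; true; false] _ p8).
  by exists [:: false; true];
    exact: (@prefix_word_catl _ xF [:: false; true; false; false] _ p8).
have [u pu] := IH (~~ c).
have [t et] : exists t, morph_word fib_morph (mkseq xF n.+1) = mkseq xF n.+2 ++ t.
  apply: prefix_word_le; first exact: hF.
  rewrite (mkseq_addn xF 1 n) morph_word_cat size_cat -[n.+2]/(2 + n).
  rewrite leq_add //; first by rewrite /mkseq /= x0.
  by rewrite -{1}(size_mkseq (fun j => xF (1 + j)) n) size_morph_word //; case.
have := prefix_word_image hF pu.
rewrite -cat1s !morph_word_cat morph_word_seq1 et.
case: c {IH pu} => /= pu.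
  exists (morph_word fib_morph u ++ [:: false]).
  by apply: (prefix_word_catl (v := t)); rewrite -!catA.
by exists (morph_word fib_morph u); apply: (prefix_word_catl (v := t)); rewrite -!catA.
Qed.

(** * The values of S *)

Lemma S_F_cat u v : S_F (u ++ v) = S_F u + S_F v.
Proof. by rewrite /S_F !count_cat; lia. Qed.

Lemma S_F_mkseqS xF n :
  S_F (mkseq xF n.+1) = S_F (mkseq xF n) + (if xF n then 1 else 3).
Proof. by rewrite mkseq_cat1 S_F_cat; case: (xF n). Qed.

Lemma S_F_size (w : seq bool) : S_F w + 2 * count_mem true w = 3 * size w.
Proof. by rewrite /S_F; have := size_count_bool w; lia. Qed.

Lemma S_language xF m : fixed_point fib_morph xF ->
  (exists2 w, language xF w & S_F w = m) <->
  exists n, m = (S_F (mkseq xF n)).+1 \/ m = (S_F (mkseq xF n)).+3.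
Proof.
move=> hF; split=> [[w [w0 [i wE]] <-]|].
  have [n sw] : exists n, size w = n.+1 by case: w w0 {wE} => // c w; exists (size w).
  exists n; have /andP[] := fib_count_add hF i n.
  rewrite mkseq_addn -sw -wE count_cat.
  have := S_F_size w; have := S_F_size (mkseq xF n); rewrite sw size_mkseq.
  lia.
have lang c n : exists2 w, language xF w & S_F w = S_F [:: c] + S_F (mkseq xF n).
  have [u pu] := prefix_left_special hF n c.
  exists (c :: mkseq xF n); last by rewrite -S_F_cat.
  by split=> //; exists (size u); apply: prefix_word_catr.
by case=> n [] ->; [apply: (lang true)|apply: (lang false)].
Qed.

(** Used in both directions, this makes the enumeration unique, so one explicit enumeration
    suffices. *)
Lemma increasing_enumeration_le P C D : increasing_enumeration P C ->
  increasing_enumeration P D -> forall n, C n <= D n.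
Proof.
move=> [Cinc CP] [Dinc DP] n.
have Cmono : {homo C : i j / i <= j} := homo_leq leqnn leq_trans (fun i => ltnW (Cinc i)).
have DC k : exists l, C l = D k by apply/CP/DP; exists k.
elim: n => [|n IH]; first by have [l <-] := DC 0; apply: Cmono.
have [l El] := DC n.+1; rewrite -El Cmono // ltnNge; apply/negP => /Cmono le.
by have := Dinc n; rewrite -El ltnNge (leq_trans le IH).
Qed.

(** * Factorization of x_F along delta(x_H) *)

(* x_F is cut just after the first letter of every occurrence of 00 in 0 x_F;  *)
(* S_F of the two resulting blocks is 7 and 11.                                *)
Definition return_word (k : nat) : seq bool :=
  if k == 7 then [:: false; true; false] else [:: false; true; false; true; false].

(** The morphism g, with g(a) = 01001010 and g(b) = 01010, factored through [delta]. *)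
Definition h_code (c : letter) : seq bool := morph_word return_word (delta c).

Lemma h_code_conj w : morph_word h_code (morph_word h w) =
  morph_word fib_morph (morph_word fib_morph (morph_word h_code w)).
Proof.
elim: w => // c w IH.
by rewrite -cat1s !morph_word_cat IH; congr (_ ++ _); case: c.
Qed.

(** If g(p) is a prefix of x_F, so is its image under f^2, which is g(h(p)); as h at least doubles
    lengths, h(p) contains a longer prefix of x_H. *)
Lemma h_code_image xF xH : fixed_point fib_morph xF -> xH 0 = La ->
  fixed_point h xH -> is_image h_code xH xF.
Proof.
move=> hF hHa hH n; rewrite -/(prefix_word _ _).
have h2 c : 1 < size (h c) by case: c.
have szh w : 2 * size w <= size (morph_word h w).
  elim: w => // c w IH.
  rewrite -cat1s morph_word_cat morph_word_seq1 !size_cat mulnDr.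
  by rewrite leq_add ?h2.
elim: n => [//|[|n] IH].
  by rewrite /mkseq /= hHa; apply: fib_prefix8.
have := prefix_word_image hF (prefix_word_image hF IH).
rewrite -h_code_conj.
have [|t ->] := @prefix_word_le _ xH (morph_word h (mkseq xH n.+1)) n.+2 (hH _).
  by apply: leq_trans (szh _); rewrite size_mkseq; lia.
by rewrite morph_word_cat; apply: prefix_word_catl.
Qed.

Lemma delta_image_letter xH y : is_image delta xH y -> forall n, y n = 7 \/ y n = 11.
Proof.
move=> im n; have le : n < size (morph_word delta (mkseq xH n.+1)).
  by rewrite -{1}(size_mkseq xH n.+1) size_morph_word //; case.
have e : nth 0 (morph_word delta (mkseq xH n.+1)) n = y n.
  by rewrite (im n.+1) nth_mkseq.
have : y n \in morph_word delta (mkseq xH n.+1) by rewrite -e mem_nth.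
elim: (mkseq xH n.+1) => // c w IH.
rewrite -cat1s morph_word_cat mem_cat morph_word_seq1 => /orP [|/IH //].
by case: c; rewrite !inE; [case/orP|] => /eqP ->; auto.
Qed.

Lemma return_word_image xF xH y : is_image h_code xH xF ->
  is_image delta xH y -> is_image return_word y xF.
Proof.
move=> hF im n; rewrite -/(prefix_word _ _).
have := hF n; rewrite -morph_word_comp -/(prefix_word _ _).
have [|t ->] := @prefix_word_le _ y (morph_word delta (mkseq xH n)) n (im n).
  by rewrite -{1}(size_mkseq xH n) size_morph_word //; case.
by rewrite morph_word_cat; apply: prefix_word_catl.
Qed.

(** * The missing integers and their gaps *)

(* C n = 2 + S_F (q n), where q n is the concatenation of the first n blocks.  *)
Lemma complement_enumeration xF y : fixed_point fib_morph xF ->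
  (forall n, y n = 7 \/ y n = 11) -> is_image return_word y xF ->
  exists2 C, increasing_enumeration (S_complement xF) C & Delta C =1 y.
Proof.
move=> hF y711 im.
pose q n := morph_word return_word (mkseq y n); pose s j := S_F (mkseq xF j).
have qS n : q n.+1 = q n ++ return_word (y n).
  by rewrite /q mkseq_cat1 morph_word_cat morph_word_seq1.
have sq n j : j <= size (return_word (y n)) ->
    s (size (q n) + j) = S_F (q n) + S_F (take j (return_word (y n))).
  move=> le; rewrite /s; have := im n.+1; rewrite -/(prefix_word _ _) -/(q _) qS.
  rewrite -{1}(cat_take_drop j (return_word _)) catA => /prefix_word_catl.
  by rewrite /prefix_word size_cat size_takel // => <-; rewrite S_F_cat.
have smono : {homo s : i j / i <= j}.
  apply: homo_leq => [//||i]; first exact: leq_trans.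
  by rewrite /s S_F_mkseqS leq_addr.
pose C n := (S_F (q n)).+2.
have CS n : C n.+1 = C n + y n.
  by rewrite /C qS S_F_cat; case: (y711 n) => ->.
have Cinc n : C n < C n.+1 by rewrite CS; case: (y711 n) => ->; lia.
exists C; last by move=> n; rewrite /Delta CS addKn.
split=> // m; rewrite /S_complement (S_language m hF) -/s; split.
  case=> m0 nS.
  have [m1|m2] := leqP m 1.
    by case: nS; exists 0; left; rewrite /S_F /=; lia.
  have [n /andP [lo hi]] : exists n, C n <= m < C n.+1.
    elim: m m2 {m0 nS} => // m IH; rewrite ltnS leq_eqVlt => /orP [/eqP <-|/IH].
      by exists 0; apply/andP; split; [|apply: Cinc 0].
    case=> n /andP [lo hi]; have [hi2|hi2] := ltnP m.+1 (C n.+1).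
      by exists n; rewrite hi2 (leq_trans lo).
    by exists n.+1; rewrite hi2 (leq_ltn_trans hi).
  have [-> //|ne] := eqVneq m (C n); first by exists n.
  have near j : j <= size (return_word (y n)) ->
      let d := S_F (q n) + S_F (take j (return_word (y n))) in
      m <> d.+1 /\ m <> d.+3.
    move=> le d; rewrite /d -sq //.
    by split=> e; case: nS; exists (size (q n) + j); [left|right].
  (* Relative to S_F (q n), the prefixes ending in the block have weights 0, 3, 4, 7, followed by 8,
     11 for the long block. Adding 1 or 3 to these covers 3 to 8, respectively 3 to 12, which is
     everything strictly between C n and C (n + 1). *)
  case: nS; move: near lo hi ne; rewrite CS /C.
  case: (y711 n) => -> near; rewrite /return_word /= in near;
    have := near 0 isT; have := near 1 isT; have := near 2 isT; have := near 3 isT.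
    by rewrite /S_F /=; lia.
  by have := near 4 isT; have := near 5 isT; rewrite /S_F /=; lia.
case=> n <-; split=> // -[j].
have s0 : s (size (q n)) = S_F (q n).
  by have := sq n 0 isT; rewrite take0 addn0 addn0.
(* Reaching C n would need a prefix of weight S_F (q n) + 1 or S_F (q n) - 1. Neither exists: the
   next block starts with 0, and [q n] is empty or ends with 0, so the neighbouring weights are 3
   away. *)
have up : size (q n) < j -> (S_F (q n)).+3 <= s j.
  move=> lt; apply: leq_trans (smono _ _ lt).
  have -> : (size (q n)).+1 = size (q n) + 1 by rewrite addn1.
  by rewrite sq; case: (y711 n) => -> //=; rewrite /S_F /=; lia.
have dn : j < size (q n) -> (s j).+3 <= S_F (q n).
  case: n {s0 up} => // n; rewrite qS size_cat => lt.
  have [r rE] : exists r, return_word (y n) = r ++ [:: false].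
    by case: (y711 n) => ->;
      [exists [:: false; true]|exists [:: false; true; false; true]].
  have := sq n (size r); rewrite rE take_size_cat // !S_F_cat
    size_cat leq_addr => /(_ isT).
  have le : j <= size (q n) + size r by move: lt; rewrite rE size_cat /=; lia.
  by have := smono _ _ le; rewrite -[S_F [:: false]]/3; lia.
rewrite -/(s j) /C; case: (ltngtP j (size (q n))) => [/dn|/up|->]; rewrite ?s0; lia.
Qed.

Theorem theorem5 (xF : nat -> bool) (xH : nat -> letter)
    (hF : fixed_point fib_morph xF)
    (hHa : xH 0 = La) (hH : fixed_point h xH) :
  (exists C, increasing_enumeration (S_complement xF) C) /\
  (forall C, increasing_enumeration (S_complement xF) C ->
     is_image delta xH (Delta C)).
Proof.
have [|y yim] := @image_exists _ _ delta 0 xH; first by case.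
have [C CP CD] : exists2 C, increasing_enumeration (S_complement xF) C & Delta C =1 y.
  apply: complement_enumeration => //; first exact: delta_image_letter yim.
  exact: return_word_image (h_code_image hF hHa hH) yim.
split; first by exists C.
move=> D DP; have DC n : D n = C n.
  by apply/eqP; rewrite eqn_leq !(increasing_enumeration_le (P := S_complement xF)).
move=> n /=; rewrite {1}yim; apply: eq_mkseq => i.
by rewrite -CD /Delta !DC.
Qed.
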